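(* Let $k\geq 1$ and $n\geq 0$. Then \[ \mathcal{T}_k(n)=\bigcup_{\lambda\in\mathcal{D}_k(n)}\ \bigcup_{\substack{d\geq 1,\ k\nmid d\\ F_{k,d}\cap\lambda\neq\emptyset}}\mathcal{T}_{\lambda,k,d}, \] and the sets $\mathcal{T}_{\lambda,k,d}$ (for the different pairs $(\lambda,d)$) are pairwise disjoint.
   Context: A partition of $n$ is a finite nonincreasing sequence of positive integers summing to $n$. $\mathcal{D}_k(n)$ is the set of partitions of $n$ in which no part occurs $k$ or more times; $\mathcal{T}_k(n)$ is the set of partitions of $n$ in which exactly one part value occurs more than $k$ times and fewer than $2k$ times while every other part value occurs fewer than $k$ times. For $k\geq 2$, every positive integer $N$ is uniquely $N=k^m d$ with $m\geq0$, $k\nmid d$; for $k\nmid d$ let $F_{k,d}=\{k^md:m\geq 0\}$, and let $F_{k,d}\cap\lambda$ be the set of distinct part values of $\lambda$ lying in $F_{k,d}$. (When $k=1$ there is no $d$ with $1\nmid d$, so the inner union is empty.) For $\lambda\in\mathcal{D}_k(n)$ and such $d$ with $F_{k,d}\cap\lambda=\{k^{a_1}d,\dots,k^{a_p}d\}$, $0\leq a_1<\cdots<a_p$, and for $1\leq i\leq p-1$, let $\tau^i_d$ be the partition obtained from $\lambda$ by replacing one part equal to $k^{a_{i+1}}d$ by $k$ parts equal to $k^{a_i}d$ together with $k-1$ parts equal to $k^{a_i+t}d$ for each $t=1,2,\dots,a_{i+1}-a_i-1$. Define $\mathcal{T}_{\lambda,k,d}=\{\tau^1_d,\dots,\tau^{p-1}_d\}$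 (empty if $p=1$). *)

(* Defs.v *)
From mathcomp Require Import all_boot.
From mathcomp Require Import classical_sets.

Set Implicit Arguments.
Unset Strict Implicit.
Unset Printing Implicit Defensive.

Local Open Scope nat_scope.
Local Open Scope classical_set_scope.

Definition partitions (n : nat) : set (seq nat) :=
  [set s | [/\ sorted geq s, all (leq 1) s & sumn s = n]].

Definition Dk (k n : nat) : set (seq nat) :=
  [set s | partitions n s /\ forall x, x \in s -> count_mem x s < k].

(* The last clause bounds all the other multiplicities by k, which makes x the
   only part value with multiplicity strictly between k and 2k. *)
Definition Tk (k n : nat) : set (seq nat) :=
  [set s | partitions n s /\
     exists x, [/\ x \in s, k < count_mem x s < 2 * k &
                   forall y, y \in s -> y != x -> count_mem y s < k]].

Definition family (k d : nat) : set nat := [set k ^ m * d | m in [set: nat]].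

Definition family_parts (k d : nat) (lam : seq nat) : set nat :=
  family k d `&` [set` lam].

(* [:: a_1; ...; a_p] lists the exponents of the elements of
   family_parts k d lam; it is unique as soon as 2 <= k and 1 <= d. *)
Definition exponents (k d : nat) (lam a : seq nat) : Prop :=
  sorted ltn a /\ family_parts k d lam = [set k ^ m * d | m in [set` a]].

(* One part k ^ b * d of lam is replaced; sorting puts the resulting multiset
   of parts back in nonincreasing order. *)
Definition tau (k d : nat) (lam : seq nat) (a b : nat) : seq nat :=
  sort geq (nseq k (k ^ a * d)
            ++ flatten [seq nseq (k - 1) (k ^ (a + t) * d)
                       | t <- iota 1 (b - a - 1)]
            ++ rem (k ^ b * d) lam).

(* Positions in a are counted from 0. *)
Definition Tlam (k : nat) (lam : seq nat) (d : nat) : set (seq nat) :=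
  [set s | exists a i, [/\ exponents k d lam a, i.+1 < size a &
                           s = tau k d lam (nth 0 a i) (nth 0 a i.+1)]].

Definition bases (k : nat) (lam : seq nat) : set nat :=
  [set d | [/\ 1 <= d, ~~ (k %| d) & family_parts k d lam !=set0]].

(* Main.v *)
(** A step lam -> tau trades one part [k ^ b * d] for a multiset of parts
    [k ^ j * d], [a <= j < b], with the same sum.  It can be undone from
    [s = tau] alone: the unique part of multiplicity above [k] is [k ^ a * d],
    which determines [a] and [d], and [b] is the least exponent above [a] such
    that [k ^ b * d] does not have multiplicity exactly [k - 1] in [s]. *)
Require Import Defs.
From mathcomp Require Import all_boot.
From mathcomp Require Import classical_sets.
From mathcomp Require Import zify.

Local Open Scope nat_scope.
Local Open Scope classical_set_scope.

(** * Factorization as [k ^ m * d], and nonincreasing sequences as multisets *)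

Lemma expn_mul_inj (k d i j : nat) :
  1 < k -> 0 < d -> (k ^ i * d == k ^ j * d) = (i == j).
Proof. by move=> k1 d0; rewrite eqn_pmul2r // eqn_exp2l. Qed.

Lemma expn_mul_uniq (k a b d e : nat) :
  1 < k -> ~~ (k %| d) -> ~~ (k %| e) -> k ^ a * d = k ^ b * e ->
  a = b /\ d = e.
Proof.
move=> k1 kd ke; have k0 : 0 < k by lia.
elim: a b => [|a IH] [|b].
- by rewrite !expn0 !mul1n.
- by rewrite mul1n expnS -mulnA => E; rewrite E dvdn_mulr in kd.
- by rewrite mul1n expnS -mulnA => E; rewrite -E dvdn_mulr in ke.
- by rewrite !expnS -!mulnA => /eqP; rewrite eqn_pmul2l // => /eqP/IH[-> ->].
Qed.

Lemma expn_mul_exists (k N : nat) :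
  1 < k -> 0 < N -> exists a d, [/\ 0 < d, ~~ (k %| d) & N = k ^ a * d].
Proof.
move=> k1; have [m] := ubnP N; elim: m N => // m IH N Nm N0.
have [/dvdnP[q Nq]|kN] := boolP (k %| N); last first.
  by exists 0, N; rewrite mul1n.
have q0 : 0 < q by lia.
have [|a [d [d0 kd qE]]] := IH q _ q0; first by nia.
by exists a.+1, d; split; rewrite // Nq qE expnS mulnC mulnA.
Qed.

Lemma count_mem_cons (s : seq nat) (x y : nat) :
  count_mem y (x :: s) = (x == y) + count_mem y s.
Proof. by []. Qed.

Lemma mem_leq_sumn (s : seq nat) (x : nat) : x \in s -> x <= sumn s.
Proof. by move=> /perm_to_rem/perm_sumn->; apply: leq_addr. Qed.

Lemma sorted_geq_perm (s t : seq nat) :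
  sorted geq s -> sorted geq t -> perm_eq s t -> s = t.
Proof.
apply: sorted_eq; first by move=> x y z /= yx xz; apply: leq_trans xz yx.
by move=> x y /andP[/= xy yx]; apply/eqP; rewrite eqn_leq xy yx.
Qed.

Lemma sort_geq_sorted (s : seq nat) : sorted geq (sort geq s).
Proof. by apply: sort_sorted => x y; apply: leq_total. Qed.

(** * The parts inserted by a step: sum and multiplicities *)

Definition new_parts (k d a b : nat) : seq nat :=
  nseq k (k ^ a * d)
  ++ flatten [seq nseq (k - 1) (k ^ (a + t) * d) | t <- iota 1 (b - a - 1)].

(** The upper exponent has the form [a + _] so that the truncated subtraction in [new_parts]
    computes. With [new_parts1] as base case, this gives induction on [b] starting from
    [b = a + 1]. *)
Lemma new_partsS (k d a m : nat) :
  new_parts k d a (a + m.+2)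
  = new_parts k d a (a + m.+1) ++ nseq (k - 1) (k ^ (a + m.+1) * d).
Proof.
have iotaS : iota 1 m.+1 = rcons (iota 1 m) m.+1
  by rewrite -cats1 -[in LHS](addn1 m) iotaD.
rewrite /new_parts !addKn !subSS !subn0 iotaS map_rcons -cats1 flatten_cat /=.
by rewrite cats0 catA.
Qed.

Lemma new_parts1 (k d a : nat) : new_parts k d a (a + 1) = nseq k (k ^ a * d).
Proof. by rewrite /new_parts addKn cats0. Qed.

(** Carrying in base [k]: the [k] copies of [k ^ a * d] make [k ^ a.+1 * d], and each further block
    of [k - 1] copies of [k ^ j * d] raises the running sum from [k ^ j * d] to [k ^ j.+1 * d]. *)
Lemma sumn_new_parts (k d a b : nat) :
  0 < k -> a < b -> sumn (new_parts k d a b) = k ^ b * d.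
Proof.
move=> k0 /subnKC <-; rewrite addSnnS; elim: (b - a.+1) => [|m IH].
  by rewrite new_parts1 sumn_nseq addn1 expnS mulnC mulnA.
rewrite new_partsS sumn_cat IH sumn_nseq [a + m.+2]addnS expnS; nia.
Qed.

Lemma mem_new_parts (k d a b x : nat) :
  a < b -> x \in new_parts k d a b -> exists j, x = k ^ j * d.
Proof.
move=> /subnKC <-; rewrite addSnnS; elim: (b - a.+1) => [|m IH].
  by rewrite new_parts1 mem_nseq => /andP[_ /eqP->]; exists a.
rewrite new_partsS mem_cat mem_nseq => /orP[/IH //|/andP[_ /eqP->]].
by exists (a + m.+1).
Qed.

Lemma count_new_parts (k d a b j : nat) :
  1 < k -> 0 < d -> a < b ->
  count_mem (k ^ j * d) (new_parts k d a b) = k * (j == a) + (k - 1) * (a < j < b).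
Proof.
move=> k1 d0 /subnKC <-; rewrite addSnnS; elim: (b - a.+1) => [|m IH].
  rewrite new_parts1 count_nseq /= expn_mul_inj // eq_sym; lia.
rewrite new_partsS count_cat IH count_nseq /= expn_mul_inj //.
have [<-|ne] := eqVneq (a + m.+1) j; first by lia.
have -> : (a < j < a + m.+2) = (a < j < a + m.+1) by lia.
by lia.
Qed.

(** * Adjacent exponents of a family in a partition *)

Definition consecutive (k d : nat) (lam : seq nat) (a b : nat) : Prop :=
  [/\ a < b, k ^ a * d \in lam, k ^ b * d \in lam &
      forall j, a < j < b -> k ^ j * d \notin lam].

Lemma mem_exponents (k d : nat) (lam e : seq nat) (j : nat) :
  1 < k -> 0 < d -> exponents k d lam e -> (j \in e) = (k ^ j * d \in lam).
Proof.
move=> k1 d0 [_ E]; apply/idP/idP => H.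
  have : family_parts k d lam (k ^ j * d) by rewrite E; exists j.
  by case.
have : family_parts k d lam (k ^ j * d) by split => //; exists j.
by rewrite E => -[i /= ie /eqP]; rewrite expn_mul_inj // => /eqP <-.
Qed.

Lemma exponents_exist (k d : nat) (lam : seq nat) :
  1 < k -> 0 < d -> exists e, exponents k d lam e.
Proof.
(* The range is large enough: if [k ^ j * d] is a part, then
   [j < k ^ j <= k ^ j * d <= sumn lam]. *)
move=> k1 d0; exists [seq j <- iota 0 (sumn lam).+1 | k ^ j * d \in lam].
split; first exact/(sorted_filter ltn_trans)/iota_ltn_sorted.
apply/seteqP; split => x.
  move=> [[j _ <-] xs]; exists j => //; rewrite /mkset mem_filter xs mem_iota.
  by have := mem_leq_sumn _ _ xs; have := ltn_expl j k1; nia.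
by move=> [j]; rewrite /mkset mem_filter => /andP[xs _] <-; split => //; exists j.
Qed.

Lemma sorted_ltn_nth_mono (e : seq nat) (i j : nat) :
  sorted ltn e -> i < size e -> j < size e -> (nth 0 e i < nth 0 e j) = (i < j).
Proof.
move=> se ie je; have homo := sorted_ltn_nth ltn_trans 0 se.
case: (ltngtP i j) => [ij|ji|->]; last exact: ltnn.
  exact: homo.
by apply/negbTE; rewrite -leqNgt ltnW // homo.
Qed.

(** Removes the exponent list and its positions: from here on only membership in [lam] of values
    [k ^ j * d] matters. *)
Lemma TlamP (k d : nat) (lam s : seq nat) :
  1 < k -> 0 < d ->
  Tlam k lam d s <-> exists a b, consecutive k d lam a b /\ s = tau k d lam a b.
Proof.
move=> k1 d0; split.
  move=> [e [i [He ie ->]]]; exists (nth 0 e i), (nth 0 e i.+1); split => //.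
  have [se _] := He; have mem j := mem_exponents k d lam e j k1 d0 He.
  split; [|by rewrite -mem mem_nth // ltnW|by rewrite -mem mem_nth|].
    by rewrite sorted_ltn_nth_mono // ltnW.
  move=> j; rewrite -mem; apply: contraTN => /(nthP 0)[l le <-].
  by rewrite !sorted_ltn_nth_mono //; lia.
move=> [a [b [[ab al bl nl] ->]]].
have [e He] := exponents_exist k d lam k1 d0.
have [se _] := He; have mem j := mem_exponents k d lam e j k1 d0 He.
move: al bl; rewrite -!mem => /(nthP 0)[i ie aE] /(nthP 0)[l le bE].
have il : i < l by rewrite -(sorted_ltn_nth_mono e) // aE bE.
have ie1 : i.+1 < size e := leq_ltn_trans il le.
exists e, i; split; rewrite // aE -bE.
(* Otherwise the entry at position [i.+1] would be an exponent strictly between [a] and [b]. *)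
have [->//|ne] := eqVneq i.+1 l.
suff /nl : a < nth 0 e i.+1 < b by rewrite -mem mem_nth.
by rewrite -aE -bE !sorted_ltn_nth_mono //; lia.
Qed.

(** * Multiplicities after a step *)

Lemma perm_tau (k d a b : nat) (lam : seq nat) :
  k ^ b * d \in lam ->
  perm_eq (k ^ b * d :: tau k d lam a b) (new_parts k d a b ++ lam).
Proof.
move=> bl; rewrite perm_sym.
apply: (perm_trans (y := new_parts k d a b ++ k ^ b * d :: rem (k ^ b * d) lam)).
  by rewrite perm_cat2l perm_to_rem.
by rewrite perm_catC /= perm_cons perm_sym /tau perm_sort catA perm_catC.
Qed.

Lemma Dk_count (k n : nat) (lam : seq nat) (x : nat) :
  0 < k -> Dk k n lam -> count_mem x lam < k.
Proof.
move=> k0 [_ H]; have [/H //|/count_memPn -> //] := boolP (x \in lam).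
Qed.

Section Step.
Variables (k n d a b : nat) (lam : seq nat).
Hypotheses (k1 : 1 < k) (d0 : 0 < d) (lamD : Dk k n lam).
Hypothesis cons_ab : consecutive k d lam a b.
Let s := tau k d lam a b.

(** The removed part is counted on the left, which avoids truncated subtraction. The multiplicities
    at [a], between [a] and [b], at [b] and elsewhere in the family are all read off from this
    identity. *)
Lemma count_tau (j : nat) :
  count_mem (k ^ j * d) s + (j == b)
  = k * (j == a) + (k - 1) * (a < j < b) + count_mem (k ^ j * d) lam.
Proof.
have [ab _ bl _] := cons_ab.
have /permP/(_ (pred1 (k ^ j * d))) := perm_tau k d a b lam bl.
by rewrite count_cat count_new_parts //= expn_mul_inj // eq_sym => <-; rewrite addnC.
Qed.

Lemma count_tau_other (y : nat) :
  (forall j, y <> k ^ j * d) -> count_mem y s = count_mem y lam.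
Proof.
have [ab _ bl _] := cons_ab => ny.
have /permP/(_ (pred1 y)) := perm_tau k d a b lam bl.
rewrite count_cat /= (count_memPn (x := y) (s := new_parts k d a b) _).
  by case: eqP => // yE; case: (ny b).
by apply/negP => /mem_new_parts[] // j /ny.
Qed.

(** In [lam] this value occurs at least once and fewer than [k] times, and the step adds [k]
    copies. *)
Lemma count_tau_base : k < count_mem (k ^ a * d) s < 2 * k.
Proof.
have [ab al _ _] := cons_ab; move: al; rewrite -has_pred1 has_count => al.
have := Dk_count k n lam (k ^ a * d) ltac:(lia) lamD.
by have := count_tau a; rewrite eqxx; lia.
Qed.

Lemma count_tau_between (j : nat) : a < j < b -> count_mem (k ^ j * d) s = k - 1.
Proof.
have [_ _ _ nl] := cons_ab => /[dup] ajb /nl /count_memPn cj.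
by have := count_tau j; rewrite cj; lia.
Qed.

Lemma count_tau_end : count_mem (k ^ b * d) s < k - 1.
Proof.
have [ab _ _ _] := cons_ab.
have := Dk_count k n lam (k ^ b * d) ltac:(lia) lamD.
by have := count_tau b; rewrite eqxx; lia.
Qed.

Lemma count_tau_lt (y : nat) : y != k ^ a * d -> count_mem y s < k.
Proof.
move=> ya; have lamk x := Dk_count k n lam x ltac:(lia) lamD.
have [[j yE]|ny] := boolp.pselect (exists j, y = k ^ j * d); last first.
  by rewrite count_tau_other // => j yE; apply: ny; exists j.
move: ya; rewrite yE expn_mul_inj // => ja.
have [/count_tau_between ->|ajb] := boolP (a < j < b); first by lia.
by have := count_tau j; have := lamk (k ^ j * d); lia.
Qed.

Lemma tau_Tk : Tk k n s.
Proof.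
have [ab al bl _] := cons_ab; have [[_ lam0 lamn] _] := lamD.
have ps := perm_tau k d a b lam bl.
split; first split.
- exact: sort_geq_sorted.
- apply/allP => x xs; have : x \in k ^ b * d :: s by rewrite inE xs orbT.
  rewrite (perm_mem ps) mem_cat => /orP[|/(allP lam0) //].
  by move=> /mem_new_parts[//|j ->]; rewrite muln_gt0 expn_gt0 d0; lia.
- apply/eqP; rewrite -(eqn_add2l (k ^ b * d)); apply/eqP.
  by have := perm_sumn ps; rewrite sumn_cat sumn_new_parts ?lamn //; lia.
exists (k ^ a * d); split.
- by rewrite -has_pred1 has_count; have := count_tau_base; lia.
- exact: count_tau_base.
- by move=> y _; apply: count_tau_lt.
Qed.

End Step.

(** * Undoing a step: existence and uniqueness *)

Lemma Tk_tau (k n : nat) (s : seq nat) :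
  1 < k -> Tk k n s ->
  exists lam d a b, [/\ Dk k n lam, 0 < d, ~~ (k %| d), consecutive k d lam a b
                      & s = tau k d lam a b].
Proof.
move=> k1 [[ss s0 sn] [x [xs cx cy]]].
have x0 : 0 < x by move/allP: s0; apply.
have [a [d [d0 kd xE]]] := expn_mul_exists k x k1 x0.
have cs y : y != x -> count_mem y s < k.
  move=> yx; have [ys|/count_memPn->] := boolP (y \in s); [exact: cy|lia].
have exb : exists b, (a < b) && (count_mem (k ^ b * d) s != k - 1).
  (* This power times [d] exceeds [n], so it is not a part of [s], and its multiplicity 0 differs
     from [k - 1] because [1 < k]. *)
  exists (a + n).+1; rewrite ltnS leq_addr /=.
  have /count_memPn -> : k ^ (a + n).+1 * d \notin s; last by lia.
  apply/negP => /mem_leq_sumn; rewrite sn.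
  by have := ltn_expl (a + n).+1 k1; nia.
have [b /andP[ab cb] minb] := ex_minnP exb.
have cab j : a < j < b -> count_mem (k ^ j * d) s = k - 1.
  move=> /andP[aj jb]; apply/eqP; apply: contraTT jb => cj.
  by rewrite -leqNgt minb // aj.
have csj j : j != a -> count_mem (k ^ j * d) s < k.
  by move=> ja; apply: cs; rewrite xE expn_mul_inj.
(* By the choice of [b], [s] contains all the parts to be deleted: more than [k] copies at [a] and
   [k - 1] at each exponent in between. Their complement [u] in [k ^ b * d :: s] is [lam] before
   sorting. *)
have /count_subseqP[v /perm_to_subseq[u pu] pv] :
    forall y, count_mem y (new_parts k d a b) <= count_mem y (k ^ b * d :: s).
  move=> y; have [/mem_new_parts[//|j ->]|/count_memPn->//] :=
    boolP (y \in new_parts k d a b).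
  rewrite count_new_parts // count_mem_cons expn_mul_inj //.
  have [->|ja] := eqVneq j a; first by rewrite -xE ltnn !muln0 muln1; lia.
  by case ajb: (a < j < b); [rewrite cab //|]; lia.
pose lam := sort geq u.
have ps : perm_eq (k ^ b * d :: s) (new_parts k d a b ++ lam).
  apply: (perm_trans pu); apply: perm_cat; first by rewrite perm_sym.
  by rewrite perm_sym perm_sort.
have clam j : count_mem (k ^ j * d) s + (j == b)
    = k * (j == a) + (k - 1) * (a < j < b) + count_mem (k ^ j * d) lam.
  move/permP/(_ (pred1 (k ^ j * d))): ps.
  by rewrite count_mem_cons count_cat count_new_parts // expn_mul_inj // eq_sym => <-; rewrite addnC.
(* The deletion leaves a copy at [a], where [s] has more than [k], and nothing strictly between; the
   part at [b] has been added by hand. *)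
have con : consecutive k d lam a b.
  split=> //.
  - rewrite -has_pred1 has_count; have := clam a; rewrite eqxx -xE; lia.
  - rewrite -has_pred1 has_count; have := clam b; rewrite eqxx; lia.
  - move=> j ajb; apply/count_memPn; have := clam j; rewrite cab //; lia.
have [_ _ bl _] := con.
exists lam, d, a, b; split => //; last first.
  apply: sorted_geq_perm => //; first exact: sort_geq_sorted.
  rewrite -(perm_cons (k ^ b * d)); apply: (perm_trans ps).
  by rewrite perm_sym perm_tau.
split; first split.
- exact: sort_geq_sorted.
- apply/allP => y yl; have : y \in k ^ b * d :: s.
    by rewrite (perm_mem ps) mem_cat yl orbT.
  rewrite inE => /orP[/eqP->|/(allP s0) //].
  by rewrite muln_gt0 expn_gt0 d0; lia.
- by have := perm_sumn ps; rewrite sumn_cat sumn_new_parts //=; lia.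
move=> y _; have [[j ->]|ny] := boolp.pselect (exists j, y = k ^ j * d).
  (* At [a], fewer than [2 * k] copies lose [k] of them. At [b], the multiplicity in [s] is below
     [k] and not [k - 1], so there is room for one more copy. *)
  have := clam j; have [->|ja] := eqVneq j a; first by rewrite -xE; lia.
  by have := csj j ja; have [->|jb] := eqVneq j b; lia.
have -> : count_mem y lam = count_mem y s.
  move/permP/(_ (pred1 y)): ps; rewrite count_mem_cons count_cat.
  rewrite (count_memPn (x := y) (s := new_parts k d a b) _).
    by case: eqP => // yE; case: ny; exists b.
  by apply/negP => /mem_new_parts[] // j yE; apply: ny; exists j.
by apply: cs; apply/eqP => yx; apply: ny; exists a; rewrite yx.
Qed.

(** If [b < c], then [k ^ b * d] would have multiplicity exactly [k - 1] as an intermediate value of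
    the second step, but less than [k - 1] as the end of the first. *)
Lemma tau_end_leq (k n d a b c : nat) (lam mu : seq nat) :
  1 < k -> 0 < d -> Dk k n lam ->
  consecutive k d lam a b -> consecutive k d mu a c ->
  tau k d lam a b = tau k d mu a c -> c <= b.
Proof.
move=> k1 d0 lamD lamC muC E; rewrite leqNgt; apply/negP => bc.
have [ab _ _ _] := lamC; have := count_tau_end k n d a b lam k1 d0 lamD lamC.
by rewrite E count_tau_between ?ltnn ?ab.
Qed.

Lemma tau_inj (k n d d' a a' b b' : nat) (lam mu : seq nat) :
  1 < k -> 0 < d -> 0 < d' -> ~~ (k %| d) -> ~~ (k %| d') ->
  Dk k n lam -> Dk k n mu ->
  consecutive k d lam a b -> consecutive k d' mu a' b' ->
  tau k d lam a b = tau k d' mu a' b' -> lam = mu /\ d = d'.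
Proof.
move=> k1 d0 d0' kd kd' lamD muD lamC muC E.
have [aE dE] : a = a' /\ d = d'.
  (* If the two base values differed, [k ^ a * d] would occur more than [k] times by the first step
     and fewer than [k] times by the second. *)
  apply: (expn_mul_uniq k) => //; apply/eqP; apply: contraT => ne.
  have := count_tau_lt k n d' a' b' mu k1 d0' muD muC _ ne.
  have := count_tau_base k n d a b lam k1 d0 lamD lamC.
  by rewrite E; lia.
subst a' d'; split => //.
have bE : b = b'.
  apply/eqP; rewrite eqn_leq (tau_end_leq k n d a b b' lam mu) //.
  by rewrite (tau_end_leq k n d a b' b mu lam).
subst b'; have [_ _ bl _] := lamC; have [_ _ bm _] := muC.
have [[lams _ _] _] := lamD; have [[mus _ _] _] := muD.
(* Both partitions, joined to the same inserted parts, give the common image with [k ^ b * d] added;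
   the inserted parts cancel. *)
apply: sorted_geq_perm => //; rewrite -(perm_cat2l (new_parts k d a b)).
have := perm_tau k d a b lam bl; rewrite perm_sym => /perm_trans; apply.
by rewrite E perm_tau.
Qed.

Theorem theorem4p2 (k n : nat) (hk : 1 <= k) :
  Tk k n = \bigcup_(lam in Dk k n) \bigcup_(d in bases k lam) Tlam k lam d
  /\ trivIset [set p : seq nat * nat | Dk k n p.1 /\ bases k p.1 p.2]
              (fun p => Tlam k p.1 p.2).
Proof.
(* For [k = 1] both sides are empty: no multiplicity lies strictly between 1 and 2, and every [d] is
   divisible by 1. *)
have [k1|k1] := ltnP 1 k; last first.
  have -> : k = 1 by lia.
  split; last by move=> p q [_ [_]]; rewrite dvd1n.
  apply/seteqP; split => [s [_ [x [_ H _]]]|s [lam _ [d [_]]]]; first by lia.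
  by rewrite dvd1n.
split; last first.
  move=> [lam d] [mu e] [/= lamD [d0 kd _]] [muD [e0 ke _]] [s [/= ls ms]].
  have [a [b [lamC sE]]] := (TlamP k d lam s k1 d0).1 ls.
  have [a' [b' [muC sE']]] := (TlamP k e mu s k1 e0).1 ms.
  have [-> -> //] : lam = mu /\ d = e.
  by apply: (tau_inj k n d e a a' b b') => //; rewrite -sE.
apply/seteqP; split => [s /(Tk_tau k n s k1)|s [lam lamD [d [d0 kd _]]]].
  move=> [lam [d [a [b [lamD d0 kd lamC ->]]]]]; exists lam => //; exists d.
    by split => //; exists (k ^ a * d); have [_ al _ _] := lamC; split => //; exists a.
  by apply/TlamP => //; exists a, b.
by move=> /(TlamP k d lam s k1 d0)[a [b [lamC ->]]]; apply: tau_Tk.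
Qed.
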